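(* Suppose that the KKT system (K) has a nonempty solution set and that the self-adjoint operator $\mathcal S$ satisfies $\mathcal S\succeq-\tfrac12\widehat\Sigma_h$ and $\tfrac12\widehat\Sigma_h+\sigma\mathcal A\mathcal A^*+\mathcal S\succ0$. Let $\{(x^k,w^k)\}$ be a sequence generated by Algorithm iPALM (with $\tau\in(0,2)$). Then: (a) for any solution $(x^*,w^* )\in\mathbb X\times\mathbb W$ of the KKT system (K) and any $k\ge1$, $$\|(x_e^{k+1};w_e^{k+1})\|_\Omega^2-\|(x_e^{k};w_e^{k})\|_\Omega^2\le-\Big(\frac{2-\tau}{3\tau}\|x^{k+1}-x^k\|^2+\|w^{k+1}-w^k\|_\Xi^2-2\tau\sigma\langle d^k,w_e^{k+1}\rangle\Big),$$ where $x_e:=x-x^*$ for $x\in\mathbb X$ and $w_e:=w-w^*$ for $w\in\mathbb W$; (b) the sequence $\{(x^k,w^k)\}$ is bounded; (c) any accumulation point of $\{(x^k,w^k)\}$ solves the KKT system (K); (d) the whole sequence $\{(x^k,w^k)\}$ converges to a solution of the KKT system (K).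
   Context: $\mathbb X,\mathbb W$ are finite-dimensional real Hilbert spaces. For a self-adjoint operator $\mathcal O$ write $\|\nu\|_{\mathcal O}^2:=\langle\nu,\mathcal O\nu\rangle$ (also when $\mathcal O$ is not positive semidefinite); $\succeq,\succ$ denote the semidefinite/definite order. Problem: $\min_{w\in\mathbb W}\{\varphi(w)+h(w)\mid\mathcal A^*w=c\}$, where $\varphi:\mathbb W\to(-\infty,+\infty]$ is closed proper convex, $h:\mathbb W\to\mathbb R$ is convex and continuously differentiable with Lipschitz continuous gradient, $\mathcal A:\mathbb X\to\mathbb W$ is linear with adjoint $\mathcal A^*$, and $c\in\mathbb X$. KKT system (K): $0\in\partial\varphi(w)+\nabla h(w)+\mathcal Ax$, $\ \mathcal A^*w-c=0$. $\widehat\Sigma_h:\mathbb W\to\mathbb W$ is a self-adjoint positive semidefinite linear operator such that for all $w,w'\in\mathbb W$, $h(w)\le\widehat h(w,w'):=h(w')+\langle\nabla h(w'),w-w'\rangle+\tfrac12\|w-w'\|^2_{\widehat\Sigma_h}$. For $\sigma>0$, the majorized augmented Lagrangian function is $$\mathcal L_\sigma(w;(x,w')):=\varphi(w)+\widehat h(w,w')+\langle\mathcal A^*w-c,x\rangle+\tfrac\sigma2\|\mathcal A^*w-c\|^2 .$$ Algorithm iPALM: let $\{\varepsilon_k\}$ be a summable sequence of nonnegative numbers, $\tau\in(0,2)$, $\mathcal S:\mathbb W\to\mathbb W$ a self-adjoint linear operator, $(x^0,w^0)\in\mathbb X\times\mathbb W$. For $k=0,1,\dots$: Step 1: compute $w^{k+1}\approx\overline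 w^{k+1}:=\operatorname{argmin}_{w}\{\mathcal L_\sigma(w;(x^k,w^k))+\tfrac12\|w-w^k\|_{\mathcal S}^2\}$ such that there is a vector $d^k\in\mathbb W$ with $\|d^k\|\le\varepsilon_k$ and $d^k\in\partial_w\mathcal L_\sigma(w^{k+1};(x^k,w^k))+\mathcal S(w^{k+1}-w^k)$. Step 2: $x^{k+1}:=x^k+\tau\sigma(\mathcal A^*w^{k+1}-c)$. Operators: $\Xi:=\tau\sigma\big(\tfrac12\widehat\Sigma_h+\mathcal S+\tfrac{(2-\tau)\sigma}{6}\mathcal A\mathcal A^*\big)$, $\ \Theta:=\tau\sigma\big(\widehat\Sigma_h+\mathcal S+\tfrac{(2-\tau)\sigma}{3}\mathcal A\mathcal A^*\big)$, and $\Omega(x;w):=(x;\Theta w)$ on $\mathbb X\times\mathbb W$, so that $\|(x;w)\|_\Omega^2=\|x\|^2+\|w\|_\Theta^2$. *)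

(* Defs.v *)
From HB Require Import structures.
From mathcomp Require Import all_boot all_order all_algebra.
From mathcomp Require Import all_classical all_reals all_analysis.

Set Implicit Arguments.
Unset Strict Implicit.
Unset Printing Implicit Defensive.

Import Order.TTheory GRing.Theory Num.Theory.
Import numFieldNormedType.Exports.

Local Open Scope classical_set_scope.
Local Open Scope ring_scope.

(* Positive definiteness follows from [innerxx]; completeness follows from
   finite dimension. *)
HB.mixin Record NormedModule_isHilbert (R : realType) E of NormedModule R E := {
  inner : E -> E -> R ;
  innerC : forall u v, inner u v = inner v u ;
  inner_linear : forall v a u1 u2,
    inner (a *: u1 + u2) v = a * inner u1 v + inner u2 v ;
  innerxx : forall u, inner u u = `|u| ^+ 2 }.

#[short(type="finHilbertType")]
HB.structure Definition FinHilbert (R : realType) :=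
  { E of NormedModule_isHilbert R E & NormedModule R E & Vector R E }.

Section Operators.
Context {R : realType}.
Implicit Types X W : finHilbertType R.

Definition is_adjoint X W (A : 'Hom(X, W)) (At : 'Hom(W, X)) :=
  forall x w, inner (A x) w = inner x (At w).

Definition self_adjoint W (O : 'End(W)) := is_adjoint O O.

(* Squared O-"norm", also used when O is not positive semidefinite. *)
Definition sqnorm W (O : 'End(W)) (v : W) : R := inner v (O v).

Definition psd W (O : 'End(W)) := forall v, 0 <= sqnorm O v.

Definition pd W (O : 'End(W)) := forall v, v != 0 -> 0 < sqnorm O v.

Definition loewner_ge W (O1 O2 : 'End(W)) := psd (O1 - O2).

Definition loewner_gt W (O1 O2 : 'End(W)) := pd (O1 - O2).

(* The Hilbert product structure on X * W; the library norm on X * W is the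
   (equivalent) max norm. *)
Definition prod_inner X W (p q : X * W) : R :=
  inner p.1 q.1 + inner p.2 q.2.

End Operators.

Section ConvexAnalysis.
Context {R : realType}.
Implicit Types W : finHilbertType R.

Definition proper_fun W (f : W -> \bar R) :=
  (forall w, (-oo < f w)%E) /\ (exists w, (f w < +oo)%E).

(* Used only for functions that never take the value -oo; the library
   convention 0 * +oo = 0 makes the cases t = 0 and t = 1 trivial. *)
Definition convex_efun W (f : W -> \bar R) :=
  forall (t : R) (u v : W), 0 <= t <= 1 ->
  (f (t *: u + (1 - t) *: v)%R
     <= t%:E * f u + (1 - t)%R%:E * f v)%E.

(* For proper convex functions, closedness is lower semicontinuity. *)
Definition closed_proper_convex W (f : W -> \bar R) :=
  [/\ lower_semicontinuous f, proper_fun f & convex_efun f].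

(* Empty outside the effective domain when f is proper. *)
Definition subdiff W (f : W -> \bar R) (w : W) : set W :=
  [set v | forall u, (f w + (inner v (u - w)%R)%:E <= f u)%E].

Definition is_gradient W (h : W -> R) (gradh : W -> W) :=
  forall w, is_diff w h (inner (gradh w)).

End ConvexAnalysis.

Section Problem.
Context {R : realType} {X W : finHilbertType R}.
Variables (phi : W -> \bar R) (h : W -> R) (gradh : W -> W).
Variables (A : 'Hom(X, W)) (At : 'Hom(W, X)) (c : X).

Definition KKT (x : X) (w : W) :=
  [set v + gradh w + A x | v in subdiff phi w] 0 /\ At w - c = 0.

Variable Sigma : 'End(W).

Definition hhat (w w' : W) : R :=
  h w' + inner (gradh w') (w - w') + 2^-1 * sqnorm Sigma (w - w').

Variable sigma : R.

Definition majorized_lagrangian (w : W) (xw' : X * W) : \bar R :=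
  (phi w + (hhat w xw'.2 + inner (At w - c) xw'.1
            + sigma / 2 * `|At w - c| ^+ 2)%R%:E)%E.

Variables (tau : R) (Sop : 'End(W)) (eps : nat -> R).

(* The inexactness criterion on w^{k+1} is entirely carried by the residual
   d^k; x 0 and w 0 are unconstrained. *)
Definition iPALM (x : nat -> X) (w d : nat -> W) :=
  forall k,
  [/\ `|d k| <= eps k,
      [set v + Sop (w k.+1 - w k)
         | v in subdiff (fun u => majorized_lagrangian u (x k, w k)) (w k.+1)]
        (d k)
    & x k.+1 = x k + (tau * sigma) *: (At (w k.+1) - c)].

Definition Xi : 'End(W) :=
  (tau * sigma) *:
    (2^-1 *: Sigma + Sop + ((2 - tau) * sigma / 6) *: (A \o At)%VF).

Definition Theta : 'End(W) :=
  (tau * sigma) *: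
    (Sigma + Sop + ((2 - tau) * sigma / 3) *: (A \o At)%VF).

Definition Omega (p : X * W) : X * W := (p.1, Theta p.2).

Definition sqnorm_Omega (p : X * W) : R := prod_inner p (Omega p).

End Problem.

(* Main.v *)
Require Import Defs.
From HB Require Import structures.
From mathcomp Require Import all_boot all_order all_algebra.
From mathcomp Require Import all_classical all_reals all_analysis.
From mathcomp Require Import ring lra.

(** The whole theorem rests on one inequality, part (a), which says that the
    iterates are quasi-Fejer monotone with respect to the solution set in the
    Omega-norm.

    The residual condition of the algorithm exhibits an explicit subgradient of
    phi at [w k.+1] ([subdiff_sum_quadratic], [iPALM_subgradient]). Pairing it,
    by monotonicity of the subdifferential, with the subgradient of phi at a
    solution leaves one nonlinear term, the gradients of h, for which convexity
    and the majorization by Sigma give a lower bound in -1/4 times the squared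
    Sigma-norm of the step ([gradient_three_point]). The rest is algebra of
    quadratic forms ([iPALM_descent]).

    The two conditions on Sop make Xi and Theta positive definite, hence
    coercive in finite dimension ([pd_coercive]). Cauchy-Schwarz then bounds the
    error term of (a) by a summable multiple of the next distance, so the
    squared distance to each solution converges and the successive steps vanish
    ([quasi_fejer], [iPALM_fejer]). Convergence of the distance bounds the
    iterates, which is (b). Vanishing steps make the constraint residuals
    vanish, and closedness of the graph of the subdifferential, a consequence
    of lower semicontinuity of phi, lets the optimality condition pass to the
    limit along a filter that converges to a given cluster point: this is (c).
    Finally, balls are compact, so a cluster point exists; it is a solution, the
    distance to it converges, and a cluster value of that distance is 0: this is
    (d). *)

Set Implicit Arguments.
Unset Strict Implicit.
Unset Printing Implicit Defensive.

Import Order.TTheory GRing.Theory Num.Theory.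
Import numFieldNormedType.Exports VectorInternalTheory.

Local Open Scope classical_set_scope.
Local Open Scope ring_scope.

(** * Inner products *)

Section InnerProduct.
Context {R : realType} {E : finHilbertType R}.
Implicit Types u v w : E.

Lemma innerDl u v w : inner (u + v) w = inner u w + inner v w.
Proof. by rewrite -[u]scale1r inner_linear mul1r scale1r. Qed.

Lemma inner0l w : inner 0 w = 0.
Proof.
have := innerDl 0 0 w; rewrite addr0 => h.
by apply: (addrI (inner 0 w)); rewrite addr0 -h.
Qed.

Lemma innerZl (a : R) u w : inner (a *: u) w = a * inner u w.
Proof. by rewrite -[a *: u]addr0 inner_linear inner0l addr0. Qed.

Lemma innerNl u w : inner (- u) w = - inner u w.
Proof. by rewrite -scaleN1r innerZl mulN1r. Qed.

Lemma innerBl u v w : inner (u - v) w = inner u w - inner v w.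
Proof. by rewrite innerDl innerNl. Qed.

Lemma innerDr u v w : inner w (u + v) = inner w u + inner w v.
Proof. by rewrite innerC innerDl !(innerC w). Qed.

Lemma innerZr (a : R) u w : inner w (a *: u) = a * inner w u.
Proof. by rewrite innerC innerZl innerC. Qed.

Lemma innerNr u w : inner w (- u) = - inner w u.
Proof. by rewrite innerC innerNl innerC. Qed.

Lemma innerBr u v w : inner w (u - v) = inner w u - inner w v.
Proof. by rewrite innerDr innerNr. Qed.

(** Reduces statements on the inner product to statements on the norm:
    continuity and the Cauchy-Schwarz inequality both follow from it. *)
Lemma inner_polarization u v :
  inner u v = 4^-1 * (`|u + v| ^+ 2 - `|u - v| ^+ 2).
Proof.
rewrite -!innerxx !(innerDl, innerDr, innerBl, innerBr, innerNl, innerNr).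
by rewrite (innerC v u); field.
Qed.

Lemma cauchy_schwarz u v : inner u v <= `|u| * `|v|.
Proof.
rewrite inner_polarization.
have h1 := ler_normD u v.
have h2 : `|(`|u|) - (`|v|)| <= `|u - v| by exact: ler_dist_dist.
have h3 : (`|u| - `|v|) ^+ 2 <= `|u - v| ^+ 2.
  by rewrite -[leLHS]real_normK ?num_real// lerXn2r ?nnegrE.
have h4 : `|u + v| ^+ 2 <= (`|u| + `|v|) ^+ 2.
  by rewrite lerXn2r ?nnegrE ?addr_ge0.
lra.
Qed.

Lemma cvg_inner T (F : set_system T) {FF : Filter F} (f g : T -> E) a b :
  f @ F --> a -> g @ F --> b -> inner (f x) (g x) @[x --> F] --> inner a b.
Proof.
move=> fa gb; rewrite inner_polarization.
under eq_fun do rewrite inner_polarization.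
apply: cvgM; first exact: cvg_cst.
by apply: cvgB; rewrite expr2;
  under eq_fun do rewrite expr2; apply: cvgM; apply: cvg_norm;
  [apply: cvgD|apply: cvgD|apply: cvgB|apply: cvgB].
Qed.

End InnerProduct.

(** * Topology of finite-dimensional spaces *)

Section FiniteDimension.
Context {R : realType}.

Lemma rV_linear_continuous n (E : normedModType R)
  (f : {linear 'rV[R]_n -> E}) : continuous f.
Proof.
move=> u.
have -> : (f : _ -> _) = fun v => \sum_(i < n) v ord0 i *: f (delta_mx 0 i).
  apply/funext => v; rewrite [in LHS](row_sum_delta v) linear_sum.
  by apply: eq_bigr => i _; rewrite linearZ.
refine (@cvg_big E 'I_n +%R 0 xpredT add_continuous _ (nbhs u) (index_enum _)
  (fun i v => v ord0 i *: f (delta_mx 0 i)) _ _ _) => i _.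
apply: cvgZr_tmp.
exact: (@coord_continuous _ _ _ ord0 i u).
Qed.

(** The minimum is attained when K is inhabited; 1 serves for empty K. *)
Lemma compact_pos_lower_bound (T : topologicalType) (K : set T) (f : T -> R) :
  compact K -> continuous f -> (forall x, K x -> 0 < f x) ->
  exists2 e : R, 0 < e & forall x, K x -> e <= f x.
Proof.
move=> Kc fc fpos.
have [[y0 Ky0]|K0] := pselect (exists y, K y); last first.
  by exists 1 => // x Kx; exfalso; apply: K0; exists x.
have [c Kc' cmin] : exists2 c, c \in K & forall t, t \in K -> f c <= f t.
  by apply: compact_EVT_min => //; [exists y0|exact: continuous_subspaceT].
exists (f c); first by apply: fpos; exact: set_mem.
by move=> y Ky; apply: cmin; exact: mem_set.
Qed.

(** Equivalence of norms, in the direction that needs compactness: the norm of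
    [r2v u] is continuous and positive on the unit sphere of the coordinate
    space, hence bounded below there by some e > 0, and 1/e is the constant. *)
Lemma v2r_norm_le (E : finHilbertType R) :
  exists2 C : R, 0 < C & forall v : E, `|v2r v| <= C * `|v|.
Proof.
pose K : set 'rV[R]_(dim E) := [set u | `|u| = 1].
have Kc : compact K.
  apply: bounded_closed_compact.
    by exists 1; split=> // M M1 u /= ->; exact: ltW.
  rewrite (_ : K = Num.norm @^-1` [set 1]); last by [].
  apply: preimage_closed; last exact: closed_eq.
  by move=> u _; exact: norm_continuous.
have [e e0 eP] : exists2 e : R, 0 < e & forall u, K u -> e <= `|r2v u : E|.
  apply: compact_pos_lower_bound => //.
    move=> u; apply: continuous_comp; last exact: norm_continuous.
    exact: rV_linear_continuous.
  move=> u Ku; rewrite normr_gt0; apply: contra_eq_neq Ku => /eqP.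
  rewrite -(raddf0 r2v) => /eqP/(can_inj r2vK) ->.
  by rewrite normr0 eq_sym oner_eq0.
exists e^-1; first by rewrite invr_gt0.
move=> v; have [->|v0] := eqVneq (v2r v) 0.
  by rewrite normr0 mulr_ge0 ?invr_ge0 ?(ltW e0).
have nv0 : 0 < `|v2r v| by rewrite normr_gt0.
have := eP (`|v2r v|^-1 *: v2r v).
rewrite /K /= normrZ gtr0_norm ?invr_gt0// mulVf ?gt_eqF// => /(_ erefl).
rewrite linearZZ /= v2rK normrZ gtr0_norm ?invr_gt0//.
by rewrite ler_pdivlMl// mulrC -ler_pdivlMl.
Qed.

Lemma v2r_continuous (E : finHilbertType R) : continuous (@v2r R E).
Proof.
have [C C0 CP] := v2r_norm_le E.
apply/linear_bounded_continuous/linear_boundedP.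
near=> r => v; apply: (le_trans (CP v)); rewrite ler_wpM2r//.
Unshelve. all: by end_near. Qed.

(** Factor f through coordinates: a linear map out of a coordinate space is a
    finite sum of coordinates times fixed vectors. *)
Lemma hom_continuous (V W : finHilbertType R) (f : 'Hom(V, W)) : continuous f.
Proof.
have -> : (f : V -> W) = (f \o r2v) \o v2r.
  by apply/funext => v /=; rewrite v2rK.
move=> v; apply: continuous_comp; first exact: v2r_continuous.
exact: rV_linear_continuous.
Qed.

(** The ball is the image under [r2v] of a closed set of coordinate vectors,
    bounded by the equivalence of norms. *)
Lemma ball_compact (E : finHilbertType R) (M : R) :
  compact [set v : E | `|v| <= M].
Proof.
have [C C0 CP] := v2r_norm_le E.
have -> : [set v : E | `|v| <= M] = r2v @` [set u | `|r2v u : E| <= M].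
  apply/seteqP; split=> [v vM|_ [u uM <-]//].
  by exists (v2r v); rewrite /= v2rK.
apply: continuous_compact.
  by apply: continuous_subspaceT; exact: rV_linear_continuous.
apply: bounded_closed_compact.
  exists (C * M); split; first exact: num_real.
  move=> N MN u /= uM; apply: (le_trans _ (ltW MN)).
  by rewrite -[u]r2vK (le_trans (CP _))// ler_pM2l.
rewrite (_ : [set _ | _] = (fun u => `|r2v u : E|) @^-1` [set x | x <= M])//.
apply: preimage_closed; last exact: closed_le.
move=> u _; apply: continuous_comp; last exact: norm_continuous.
exact: rV_linear_continuous.
Qed.

Lemma sqnorm_continuous (E : finHilbertType R) (O : 'End(E)) :
  continuous (sqnorm O).
Proof.
by move=> v; apply: cvg_inner; [exact: cvg_id|exact: hom_continuous].
Qed.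

(** In finite dimension definiteness is uniform: minimise the quadratic form on
    the compact unit sphere and rescale. *)
Lemma pd_coercive (E : finHilbertType R) (O : 'End(E)) : pd O ->
  exists2 l : R, 0 < l & forall v, l * `|v| ^+ 2 <= sqnorm O v.
Proof.
move=> Opd.
have [l l0 lP] : exists2 l : R, 0 < l & forall v, `|v| = 1 -> l <= sqnorm O v.
  apply: (@compact_pos_lower_bound _ [set v : E | `|v| = 1]).
  - apply: subclosed_compact (@ball_compact E 1) _; last by move=> v /= ->.
    rewrite (_ : [set _ | _] = Num.norm @^-1` [set 1])//.
    apply: preimage_closed; last exact: closed_eq.
    by move=> u _; exact: norm_continuous.
  - exact: sqnorm_continuous.
  - by move=> v v1; apply: Opd; rewrite -normr_gt0 v1.
exists l => // v; have [->|v0] := eqVneq v 0.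
  by rewrite /sqnorm inner0l normr0 expr0n mulr0.
have nv0 : 0 < `|v| by rewrite normr_gt0.
have := lP (`|v|^-1 *: v).
rewrite normrZ gtr0_norm ?invr_gt0// mulVf ?gt_eqF// => /(_ erefl).
rewrite /sqnorm linearZ innerZl innerZr mulrA -expr2 exprVn => h.
by rewrite mulrC -ler_pdivlMl ?exprn_gt0.
Qed.

End FiniteDimension.

(** * Convex functions and subdifferentials *)

Section ConvexAnalysis.
Context {R : realType} {W : finHilbertType R}.
Implicit Types (u v w z : W) (f : W -> \bar R) (h : W -> R).

Lemma gradient_inequality h (gradh : W -> W) u w :
  convex_function [set: W] h -> is_gradient h gradh ->
  h w + inner (gradh w) (u - w) <= h u.
Proof.
move=> hconv hgrad.
have [hdiff hd] := hgrad w.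
have dE : 'D_(u - w) h w = inner (gradh w) (u - w) by rewrite deriveE// hd.
have dcvg : cvg (t^-1 *: (h (t *: (u - w) + w) - h w) @[t --> 0^']).
  exact: diff_derivable.
have {}dcvg : t^-1 *: (h (t *: (u - w) + w) - h w) @[t --> 0^'+] -->
    inner (gradh w) (u - w).
  by rewrite -dE; exact: cvg_dnbhs_at_right dcvg.
suff : inner (gradh w) (u - w) <= h u - h w by lra.
apply: (@cvgr_to_le _ _ _ _ _ _ _ dcvg).
near=> t.
have t0 : 0 < t by near: t; exact: nbhs_right_gt.
have t1 : t <= 1 by near: t; exact: nbhs_right_le.
have h01 : 0 <= t <= 1 by rewrite (ltW t0).
have := hconv (Itv01 (ltW t0) t1) u w (in_setT _) (in_setT _).
rewrite convRE /= /conv /= /unstable.onem => hc.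
rewrite [_ *: _]mulrC ler_pdivrMr//.
have -> : t *: (u - w) + w = t *: u + (1 - t) *: w.
  by rewrite scalerBr scalerBl scale1r addrA addrAC.
lra.
Unshelve. all: by end_near. Qed.

(** With s = c - a, the tangent plane at b lies below the quadratic majorant
    at a, and the tangent plane at a below the majorant at b. Comparing the
    first pair at a + s/2 and the second at b - s/2 and adding gives the claim.
    Sharing the displacement s between the two points is what yields the factor
    1/4; comparing at c only would give 1/2, which is too weak to leave half of
    Sigma in the decrease of the algorithm. *)
Lemma gradient_three_point h (gradh : W -> W) (Sigma : 'End(W)) a b c :
  convex_function [set: W] h -> is_gradient h gradh ->
  (forall u u', h u <= hhat h gradh Sigma u u') ->
  - (4^-1 * sqnorm Sigma (c - a)) <= inner (gradh a - gradh b) (c - b).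
Proof.
move=> hconv hgrad hmaj.
have [s ->] : exists s, c = a + s by exists (c - a); rewrite addrC subrK.
have addKs v z : v + z - v = z by rewrite addrAC subrr add0r.
have h1 := hmaj (a + 2^-1 *: s) a.
have h2 := hmaj (b + (- 2^-1) *: s) b.
have h3 := gradient_inequality (a + 2^-1 *: s) b hconv hgrad.
have h4 := gradient_inequality (b + (- 2^-1) *: s) a hconv hgrad.
move: h1 h2 h3 h4; rewrite /hhat !addKs /sqnorm !(linearZZ Sigma).
rewrite !(innerBr, innerBl, innerDl, innerDr, innerZl, innerZr).
lra.
Qed.

Lemma le0_of_le_small (a q : R) :
  (forall t, 0 < t <= 1 -> a <= t * q) -> a <= 0.
Proof.
move=> h; rewrite leNgt; apply/negP => a0.
have q0 : 0 <= `|q| by [].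
have s0 : 0 < a + `|q| by lra.
(* at t = a / (a + |q|) the bound t * q is smaller than a *)
have : 0 < a / (a + `|q|) <= 1.
  by rewrite divr_gt0//= ler_pdivrMr// mul1r; lra.
move=> /h; rewrite mulrAC ler_pdivlMr// -subr_ge0.
have := ler_norm q; nra.
Qed.

(** Only the first-order part of q survives: evaluate the subgradient
    inequality of f + q on the segment from w to u, bound f there by convexity,
    divide by the step t and let t tend to 0. *)
Lemma subdiff_sum_quadratic f (q : W -> R) w g v :
  proper_fun f -> convex_efun f ->
  (forall z, exists Q, forall t,
     q (w + t *: z) = q w + t * inner g z + t ^+ 2 * Q) ->
  subdiff (fun u => f u + (q u)%:E)%E w v -> subdiff f w (v - g).
Proof.
move=> [fNy [p fp]] fconv qE vsub.
have fw : f w \is a fin_num.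
  rewrite fin_numElt fNy/=.
  have := vsub p; have := fNy w; have := fNy p; move: fp.
  by case: (f w) => [r| |]//; case: (f p).
move=> u /=.
have [fu|] := boolP (f u \is a fin_num); last first.
  by rewrite fin_numElt fNy/= -leNgt leye_eq => /eqP ->; rewrite leey.
have [Q qQ] := qE (u - w).
have [a aE] : exists a, f w = a%:E by exists (fine (f w)); rewrite fineK.
have [b bE] : exists b, f u = b%:E by exists (fine (f u)); rewrite fineK.
rewrite aE bE -EFinD lee_fin.
suff : a + inner (v - g) (u - w) - b <= 0 by lra.
apply: (@le0_of_le_small _ Q) => t /andP[t0 t1].
have := vsub (w + t *: (u - w)); rewrite /= qQ aE.
have -> : w + t *: (u - w) = t *: u + (1 - t) *: w.
  by rewrite scalerBr scalerBl scale1r addrA addrAC addrC addrA addrAC addrC.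
have h01 : 0 <= t <= 1 by rewrite (ltW t0).
have := fconv t u w h01; rewrite aE bE -!EFinM -EFinD.
have := fNy (t *: u + (1 - t) *: w).
case: (f _) => [r| |]// _; rewrite -!EFinD !lee_fin.
have -> : t *: u + (1 - t) *: w - w = t *: (u - w).
  by rewrite scalerBl scale1r scalerBr addrA addrAC addrK.
rewrite innerZr innerBl => h1 h2.
rewrite -(ler_pM2l t0); nra.
Qed.

Lemma subdiff_monotone f u w (v v' : W) : proper_fun f ->
  subdiff f u v -> subdiff f w v' -> 0 <= inner (v - v') (u - w).
Proof.
move=> [fNy [p fp]] vs vs'.
have fin z y : subdiff f z y -> f z \is a fin_num.
  move=> /(_ p) h; rewrite fin_numElt fNy/=; move: h fp.
  by have := fNy z; have := fNy p; case: (f z) => [r| |]//; case: (f p).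
have [fu fw] := (fin _ _ vs, fin _ _ vs').
have := vs w; have := vs' u; rewrite -(fineK fu) -(fineK fw) -!EFinD !lee_fin.
rewrite -(opprB u w) innerBl innerNr; lra.
Qed.

(** The graph of the subdifferential is closed: if the subgradient inequality
    failed at the limit for some z, a real N strictly between its two sides
    would be exceeded by f along u, by lower semicontinuity, while the
    subgradient inequality at [u t] eventually keeps [f (u t)] below N. *)
Lemma subdiff_closed f T (F : set_system T) {FF : ProperFilter F}
  (u v : T -> W) a b :
  closed_proper_convex f -> u @ F --> a -> v @ F --> b ->
  (forall t, subdiff f (u t) (v t)) ->
  subdiff f a b.
Proof.
move=> fcpc ua vb uv z /=.
have [lsc [pNy _] _] := fcpc.
have [fz|] := boolP (f z \is a fin_num); last first.
  by rewrite fin_numElt pNy/= -leNgt leye_eq => /eqP ->; rewrite leey.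
rewrite -(fineK fz) -leeBrDr// -EFinB leNgt; apply/negP.
set M := fine (f z) - inner b (z - a) => Mlt.
have [N MN Nlt] : exists2 N, M < N & (N%:E < f a)%E.
  move: Mlt; have := pNy a; case: (f a) => [r||]// _; rewrite ?lte_fin.
    by move=> hr; exists ((M + r) / 2); rewrite ?lte_fin; lra.
  by move=> _; exists (M + 1); [lra|rewrite ltry].
have [V Va VN] := lsc _ _ Nlt.
have cM : fine (f z) - inner (v t) (z - u t) @[t --> F] --> M.
  apply: cvgB; first exact: cvg_cst.
  by apply: cvg_inner => //; apply: cvgB => //; exact: cvg_cst.
have nearF : \forall t \near F,
    V (u t) /\ fine (f z) - inner (v t) (z - u t) < N.
  by near=> t; split; near: t; [exact: ua|exact: (cvgr_lt _ cM)].
have [t [/VN Nu lt]] := filter_ex nearF.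
have := uv t z; rewrite -(fineK fz) -leeBrDr// -EFinB leNgt => /negP; apply.
by apply: lt_trans Nu; rewrite lte_fin.
Unshelve. all: by end_near. Qed.

End ConvexAnalysis.

(** * Quasi-Fejer monotone sequences *)

Section Sequences.
Context {R : realType}.

Lemma cvg0_sqr_le T (F : set_system T) {FF : Filter F} (V : normedModType R)
    (u : T -> V) (b : T -> R) (m : R) :
  0 < m -> (forall t, m * `|u t| ^+ 2 <= b t) ->
  b @ F --> 0 -> u @ F --> 0.
Proof.
move=> m0 ub b0; apply/cvgr0Pnorm_lt => e e0.
have me0 : 0 < m * e ^+ 2 by rewrite mulr_gt0// exprn_gt0.
near=> t.
have bt : b t < m * e ^+ 2 by near: t; exact: (cvgr_lt _ b0).
have : `|u t| ^+ 2 < e ^+ 2 by rewrite -(ltr_pM2l m0); exact: le_lt_trans bt.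
by rewrite ltr_pXn2r// nnegrE ?normr_ge0 ?(ltW e0).
Unshelve. all: by end_near. Qed.

(** The hypothesis forces [al k.+1 <= al k + e k], so that [al - series e] is
    nonincreasing and bounded below. *)
Lemma quasi_fejer_is_cvg (al e : nat -> R) :
  (forall k, 0 <= al k) -> (forall k, 0 <= e k) -> cvgn (series e) ->
  (forall k, al k.+1 ^+ 2 <= al k ^+ 2 + e k * al k.+1) -> cvgn al.
Proof.
move=> al0 e0 ecvg step.
have lin k : al k.+1 <= al k + e k.
  rewrite leNgt; apply/negP => lt.
  by have := step k; have := al0 k; have := al0 k.+1; have := e0 k; nra.
pose u k := al k - series e k.
have unon : nonincreasing_seq u.
  apply/nonincreasing_seqP => k; rewrite /u seriesSr.
  by have := lin k; lra.
have se k : series e k <= limn (series e).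
  apply: (@nondecreasing_cvgn_le _ (series e)) => //.
  by apply: nondecreasing_series => n _ _; exact: e0.
have ucvg : cvgn u.
  apply: nonincreasing_is_cvgn => //; exists (- limn (series e)) => _ [k _ <-].
  by rewrite /u; have := se k; have := al0 k; lra.
have -> : al = u + series e by apply/funext => k; rewrite /u fctE subrK.
exact: is_cvgD.
Qed.

(** A quasi-Fejer lemma: the square root in the error term is handled by
    applying the previous lemma to [Num.sqrt \o a]; then b is squeezed between
    0 and [a k - a k.+1] plus a vanishing error. *)
Lemma quasi_fejer (a b e : nat -> R) :
  (forall k, 0 <= a k) -> (forall k, 0 <= b k) -> (forall k, 0 <= e k) ->
  cvgn (series e) ->
  (forall k, a k.+1 + b k <= a k + e k * Num.sqrt (a k.+1)) ->
  cvgn a /\ b @ \oo --> 0.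
Proof.
move=> a0 b0 e0 ecvg step.
have alcvg : cvgn (fun k => Num.sqrt (a k)).
  apply: quasi_fejer_is_cvg ecvg _ => // k.
  by rewrite !sqr_sqrtr//; have := step k; have := b0 k; lra.
have aE : a = (fun k => Num.sqrt (a k) * Num.sqrt (a k)).
  by apply/funext => k; rewrite -expr2 sqr_sqrtr.
have acvg : cvgn a by rewrite aE; apply: is_cvgM.
split=> //.
have bub : a k - a k.+1 + e k * Num.sqrt (a k.+1) @[k --> \oo] --> 0.
  rewrite -[X in _ --> X](addr0 0); apply: cvgD.
    rewrite -(subrr (limn a)); apply: cvgB; first exact: acvg.
    by rewrite -cvg_shiftS in acvg *.
  rewrite -(mul0r (limn (fun k => Num.sqrt (a k)))); apply: cvgM.
    exact: cvg_series_cvg_0.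
  by have := alcvg; rewrite -(cvg_shiftS (fun k => Num.sqrt (a k))).
apply: (@squeeze_cvgr _ _ _ _ (cst 0) _ _ _ _ _ bub); last exact: cvg_cst.
by apply: nearW => k /=; rewrite b0/=; have := step k; lra.
Qed.

(** Plays the role of extracting a subsequence: a cluster point of z along F is
    a limit of z along a finer filter on the index set. *)
Lemma cluster_refine S (T : topologicalType) (F : set_system S)
    {FF : Filter F} (z : S -> T) p : cluster (z @ F) p ->
  exists G : set_system S, [/\ ProperFilter G, G --> F & z @ G --> p].
Proof.
move=> clp.
pose G : set_system S := filter_from
  [set AB : set S * set T | F AB.1 /\ nbhs p AB.2]
  (fun AB => AB.1 `&` z @^-1` AB.2).
exists G; split.
- apply: filter_from_proper.
    apply: filter_from_filter.
      by exists (setT, setT); split; exact: filterT.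
    move=> [A1 B1] [A2 B2] /= [FA1 pB1] [FA2 pB2].
    exists (A1 `&` A2, B1 `&` B2); first by split; exact: filterI.
    by move=> s /= [[? ?] [? ?]].
  move=> [A B] /= [FA pB].
  have zA : F (z @^-1` (z @` A)) by apply: filterS FA => s As; exists s.
  by have [_ [[s As <-] Bs]] := clp _ _ zA pB; exists s.
- by move=> A FA; exists (A, setT); [split=> //; exact: filterT|move=> s []].
- by move=> B pB; exists (setT, B); [split=> //; exact: filterT|move=> s []].
Qed.

End Sequences.

(** * The inexact proximal augmented Lagrangian iteration *)

Section Algorithm.
Context {R : realType} {X W : finHilbertType R}.
Variables (phi : W -> \bar R) (h : W -> R) (gradh : W -> W).
Variables (A : 'Hom(X, W)) (At : 'Hom(W, X)) (c : X) (Sigma Sop : 'End(W)).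
Variables (sigma tau : R) (eps : nat -> R).
Variables (x : nat -> X) (w d : nat -> W).
Hypothesis phi_cpc : closed_proper_convex phi.
Hypothesis h_convex : convex_function [set: W] h.
Hypothesis h_grad : is_gradient h gradh.
Hypothesis A_adj : is_adjoint A At.
Hypothesis Sigma_sa : self_adjoint Sigma.
Hypothesis h_major : forall u u', h u <= hhat h gradh Sigma u u'.
Hypothesis gradh_cont : continuous gradh.
Hypothesis Sigma_psd : psd Sigma.
Hypothesis sigma_gt0 : 0 < sigma.
Hypothesis tau_gt0 : 0 < tau.
Hypothesis tau_lt2 : tau < 2.
Hypothesis S_sa : self_adjoint Sop.
Hypothesis eps_ge0 : forall k, 0 <= eps k.
Hypothesis eps_summable : cvgn (series eps).
Hypothesis S_ge : loewner_ge Sop (- (2^-1 *: Sigma)).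
Hypothesis S_gt : loewner_gt (2^-1 *: Sigma + sigma *: (A \o At)%VF + Sop) 0.
Hypothesis xw_iPALM : iPALM phi h gradh At c Sigma sigma tau Sop eps x w d.

Lemma inner_AAt v : inner v (A (At v)) = `|At v| ^+ 2.
Proof. by rewrite innerC A_adj innerxx. Qed.

Lemma sqnorm_Theta v : sqnorm (Theta A At Sigma sigma tau Sop) v =
  tau * sigma * (sqnorm Sigma v + sqnorm Sop v
                 + (2 - tau) * sigma / 3 * `|At v| ^+ 2).
Proof.
rewrite /sqnorm /Theta !(scale_lfunE, add_lfunE) comp_lfunE.
by rewrite !(innerZr, innerDr) inner_AAt.
Qed.

Lemma sqnorm_Xi v : sqnorm (Xi A At Sigma sigma tau Sop) v =
  tau * sigma * (2^-1 * sqnorm Sigma v + sqnorm Sop v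
                 + (2 - tau) * sigma / 6 * `|At v| ^+ 2).
Proof.
rewrite /sqnorm /Xi !(scale_lfunE, add_lfunE) comp_lfunE.
by rewrite !(innerZr, innerDr) inner_AAt.
Qed.

(** The optimality condition of the subproblem, once its quadratic part is moved
    out of the subdifferential. *)
Lemma iPALM_subgradient k :
  subdiff phi (w k.+1)
    (d k - (Sigma (w k.+1 - w k) + Sop (w k.+1 - w k)) - gradh (w k)
     - A (x k + sigma *: (At (w k.+1) - c))).
Proof.
have [lsc prop conv] := phi_cpc.
have [_ [v vsub /= <-] _] := xw_iPALM k.
set s := w k.+1 - w k; set r := At (w k.+1) - c.
have -> : v + Sop s - (Sigma s + Sop s) - gradh (w k) - A (x k + sigma *: r)
   = v - (gradh (w k) + Sigma s + A (x k + sigma *: r)).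
  rewrite !opprD !addrA (addrAC _ (- Sigma s) (- Sop s)) addrK.
  by rewrite (addrAC v (- Sigma s)).
apply: subdiff_sum_quadratic vsub => // z.
exists (2^-1 * sqnorm Sigma z + sigma / 2 * `|At z| ^+ 2) => t /=.
rewrite /hhat /sqnorm -!innerxx.
have -> : w k.+1 + t *: z - w k = s + t *: z by rewrite addrAC.
have -> : At (w k.+1 + t *: z) - c = r + t *: At z.
  by rewrite linearD linearZZ /= addrAC.
rewrite -/s -/r; clearbody s r.
rewrite !(linearD Sigma) !(linearZZ Sigma) /=.
rewrite !(innerBr, innerBl, innerDl, innerDr, innerZl, innerZr).
rewrite (A_adj (x k + sigma *: r) z) innerDl innerZl.
rewrite (innerC (At z) (x k)) (innerC (At z) r) (innerC z (Sigma s)).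
by rewrite -(Sigma_sa s z); field.
Qed.

(** Monotonicity of the subdifferential of phi between the iterate and the
    solution, with [gradient_three_point] bounding the gradient terms. The
    multiplier update turns the coupling term into a difference of squared
    distances and leaves a surplus proportional to the squared residual of
    [w k.+1]. One third of it pays for the step in x; the other two thirds pay
    for the constraint parts of Theta and Xi together, through
    |r' - r|^2 <= 2 |r'|^2 + 2 |r|^2, with r and r' the successive residuals. *)
Lemma iPALM_descent xs ws k : KKT phi gradh A At c xs ws ->
  sqnorm_Omega A At Sigma sigma tau Sop (x k.+1 - xs, w k.+1 - ws)
    - sqnorm_Omega A At Sigma sigma tau Sop (x k - xs, w k - ws)
  <= - ((2 - tau) / (3 * tau) * `|x k.+1 - x k| ^+ 2
        + sqnorm (Xi A At Sigma sigma tau Sop) (w k.+1 - w k)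
        - 2 * tau * sigma * inner (d k) (w k.+1 - ws)).
Proof.
move=> [[vs vsub /= /eqP vs0] /eqP]; rewrite subr_eq0 => /eqP Atws.
have [_ prop _] := phi_cpc.
have := subdiff_monotone prop (iPALM_subgradient k) vsub.
have := gradient_three_point (w k) ws (w k.+1) h_convex h_grad h_major.
have [_ _ ->] := xw_iPALM k.
have -> : vs = - gradh ws - A xs.
  by apply/eqP; rewrite -subr_eq0 !opprD !opprK addrA.
pose e := w k.+1 - ws; pose e0 := w k - ws; pose y := x k - xs.
have -> : At (w k.+1) - c = At e by rewrite linearB /= Atws.
have eE : w k.+1 - ws = e by [].
have e0E : w k - ws = e0 by [].
have -> : w k.+1 - w k = e - e0 by rewrite /e /e0 opprB addrA subrK.
rewrite eE e0E.
have -> : x k = xs + y by rewrite addrC subrK.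
have -> : xs + y + (tau * sigma) *: At e - xs = y + (tau * sigma) *: At e.
  by rewrite -[xs + y + _]addrA addrAC subrr add0r.
have -> : xs + y + (tau * sigma) *: At e - (xs + y) = (tau * sigma) *: At e.
  by rewrite addrAC subrr add0r.
have -> : xs + y - xs = y by rewrite addrAC subrr add0r.
(* the defect in |r' - r|^2 <= 2 |r'|^2 + 2 |r|^2 *)
have r2 : 0 <= inner (At e + At e0) (At e + At e0) by rewrite innerxx sqr_ge0.
clearbody e e0 y.
rewrite /sqnorm_Omega /Omega /prod_inner /= -/(sqnorm _ _) -/(sqnorm _ e0).
rewrite !sqnorm_Theta sqnorm_Xi /sqnorm -!innerxx -[inner e _]/(inner e _).
rewrite (linearB At) !(linearB Sigma) !(linearB Sop) /=.
move: r2.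
rewrite !(innerBr, innerBl, innerNl, innerDl, innerDr, innerZl, innerZr).
rewrite !A_adj !(innerDl, innerZl).
rewrite (innerC (At e0) (At e)) (innerC e (Sigma e0)) (Sigma_sa e0 e).
rewrite (innerC (Sigma e)) (innerC (Sop e)) (innerC e (Sop e0)) (S_sa e0 e).
rewrite (innerC (At e) y).
move: (inner (At e) (At e)) (inner (At e) (At e0)) (inner (At e0) (At e0)).
move: (inner e (Sigma e)) (inner e0 (Sigma e)) (inner e0 (Sigma e0)).
move: (inner e (Sop e)) (inner e0 (Sop e)) (inner e0 (Sop e0)).
move: (inner (gradh _) e) (inner (gradh _) e) (inner (d k) e) (inner y y).
move: (inner y _) (inner xs _) => a1 a2 a3 a4 a5 a6 b1 b2 b3 c1 c2 c3 p q r.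
move=> r2 tp mono.
have -> : (2 - tau) / (3 * tau) * (tau * sigma * (tau * sigma * p))
    = (2 - tau) / 3 * tau * sigma ^+ 2 * p.
  by field; rewrite gt_eqF.
have ts0 : 0 < tau * sigma by rewrite mulr_gt0.
have k0 : 0 <= (2 - tau) / 6 * (tau * sigma ^+ 2).
  rewrite mulr_ge0 ?divr_ge0 ?subr_ge0 ?(ltW tau_lt2)//.
  by rewrite mulr_ge0 ?sqr_ge0// ltW.
(* the gap between the two sides is the sum of r2, tp and mono with weights
   (2 - tau) tau sigma^2 / 6, 2 tau sigma and 2 tau sigma *)
move: r2 => /(mulr_ge0 k0) r2.
move: tp; rewrite -subr_ge0 => /(mulr_ge0 (ltW ts0)) tp.
move: mono => /(mulr_ge0 (ltW ts0)) mono.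
lra.
Qed.

Definition omega_sqdist xs ws k :=
  sqnorm_Omega A At Sigma sigma tau Sop (x k - xs, w k - ws).

Lemma omega_sqdistE xs ws k : omega_sqdist xs ws k =
  `|x k - xs| ^+ 2 + sqnorm (Theta A At Sigma sigma tau Sop) (w k - ws).
Proof. by rewrite /omega_sqdist /sqnorm_Omega /prod_inner /= innerxx. Qed.

Lemma half_Sigma_S_ge0 v : 0 <= 2^-1 * sqnorm Sigma v + sqnorm Sop v.
Proof.
have := S_ge v; rewrite /loewner_ge opprK /sqnorm add_lfunE scale_lfunE.
by rewrite innerDr innerZr addrC.
Qed.

(** Apart from the factor [tau * sigma], the form of Xi is the convex
    combination, with weight (2 - tau) / 6 in ]0, 1/3[, of the positive
    definite form of [S_gt] and the semidefinite one of [S_ge]. *)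
Lemma Xi_pd : pd (Xi A At Sigma sigma tau Sop).
Proof.
move=> v v0; rewrite sqnorm_Xi mulr_gt0 ?mulr_gt0//.
have := half_Sigma_S_ge0 v.
have := S_gt v0; rewrite /sqnorm subr0 !add_lfunE !scale_lfunE comp_lfunE.
rewrite !(innerDr, innerZr) inner_AAt.
move: (inner v (Sigma v)) (inner v (Sop v)) (`|At v| ^+ 2) => p q r h1 h2.
have th0 : 0 < (2 - tau) / 6 by rewrite divr_gt0 ?subr_gt0.
have th1 : 0 <= 1 - (2 - tau) / 6 by have := tau_gt0; lra.
have := mulr_ge0 th1 h2; have := mulr_gt0 th0 h1; lra.
Qed.

Lemma Theta_pd : pd (Theta A At Sigma sigma tau Sop).
Proof.
move=> v v0; apply: lt_le_trans (Xi_pd v0) _.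
rewrite sqnorm_Xi sqnorm_Theta ler_pM2l ?mulr_gt0//.
have p0 := Sigma_psd v; have r0 : 0 <= sigma * `|At v| ^+ 2.
  by rewrite mulr_ge0 ?sqr_ge0 ?ltW.
have th0 : 0 <= (2 - tau) / 6 by rewrite divr_ge0 ?subr_ge0 ?ltW.
by have := mulr_ge0 th0 r0; lra.
Qed.

Lemma omega_sqdist_coercive xs ws : exists2 l : R, 0 < l &
  forall k, `|x k - xs| ^+ 2 <= omega_sqdist xs ws k /\
            l * `|w k - ws| ^+ 2 <= omega_sqdist xs ws k.
Proof.
have [l l0 lP] := pd_coercive Theta_pd.
exists l => // k; rewrite omega_sqdistE; split.
  by rewrite lerDl (le_trans _ (lP _))// mulr_ge0 ?sqr_ge0 ?ltW.
by rewrite (le_trans (lP _))// lerDr sqr_ge0.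
Qed.

(** The inequality [iPALM_descent] is a quasi-Fejer inequality: coercivity turns
    the error [inner (d k) (w k.+1 - ws)] into a summable multiple of
    the next Omega-distance, and Xi dominates the squared steps. *)
Lemma iPALM_fejer xs ws : KKT phi gradh A At c xs ws ->
  [/\ cvgn (omega_sqdist xs ws),
      x k.+1 - x k @[k --> \oo] --> 0 & w k.+1 - w k @[k --> \oo] --> 0].
Proof.
move=> xsol.
have [l l0 lP] := omega_sqdist_coercive xs ws.
have [m m0 mP] := pd_coercive Xi_pd.
pose C := 2 * tau * sigma / Num.sqrt l.
have C0 : 0 <= C by rewrite divr_ge0 ?sqrtr_ge0// !mulr_ge0// ltW.
pose b k := (2 - tau) / (3 * tau) * `|x k.+1 - x k| ^+ 2
  + sqnorm (Xi A At Sigma sigma tau Sop) (w k.+1 - w k).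
have m'0 : 0 < (2 - tau) / (3 * tau) by rewrite divr_gt0 ?mulr_gt0 ?subr_gt0.
have Xi0 v : 0 <= sqnorm (Xi A At Sigma sigma tau Sop) v.
  by apply: le_trans (mP v); rewrite mulr_ge0 ?sqr_ge0 ?ltW.
have bx k : (2 - tau) / (3 * tau) * `|x k.+1 - x k| ^+ 2 <= b k.
  by rewrite lerDl Xi0.
have bw k : m * `|w k.+1 - w k| ^+ 2 <= b k.
  apply: le_trans (mP _) _; rewrite lerDr.
  by rewrite mulr_ge0 ?sqr_ge0 ?(ltW m'0).
have aw k : l * `|w k - ws| ^+ 2 <= omega_sqdist xs ws k by have [] := lP k.
have a0 k : 0 <= omega_sqdist xs ws k.
  by apply: le_trans (aw k); rewrite mulr_ge0 ?sqr_ge0 ?ltW.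
have [acvg b0] : cvgn (omega_sqdist xs ws) /\ b @ \oo --> 0.
  apply: (@quasi_fejer _ _ _ (C *: eps)) => // [k|k||k].
  - by apply: le_trans (bw k); rewrite mulr_ge0 ?sqr_ge0 ?ltW.
  - by rewrite fctE mulr_ge0.
  - exact: is_cvg_seriesZ.
  have := iPALM_descent k xsol; rewrite -!/(omega_sqdist _ _ _).
  have : inner (d k) (w k.+1 - ws)
      <= eps k * (Num.sqrt (omega_sqdist xs ws k.+1) / Num.sqrt l).
    apply: le_trans (cauchy_schwarz _ _) _.
    have [dk _ _] := xw_iPALM k.
    rewrite ler_pM// ler_pdivlMr ?sqrtr_gt0// mulrC.
    rewrite -(ler_pXn2r (ltn0Sn 1)) ?nnegrE ?mulr_ge0 ?sqrtr_ge0//.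
    by rewrite exprMn !sqr_sqrtr ?(ltW l0).
  have ts0 : 0 <= 2 * tau * sigma by rewrite !mulr_ge0// ltW.
  move=> /(ler_wpM2l ts0).
  have -> : (C *: eps) k = C * eps k by [].
  rewrite /b /C.
  move: (inner _ _) (omega_sqdist _ _ _) (omega_sqdist _ _ _) => *; lra.
split=> //; first exact: cvg0_sqr_le m'0 bx b0.
exact: cvg0_sqr_le m0 bw b0.
Qed.

Lemma iPALM_bounded xs ws : KKT phi gradh A At c xs ws ->
  exists M, forall k, `|x k| <= M /\ `|w k| <= M.
Proof.
move=> xsol; have [/cvg_seq_bounded abnd _ _] := iPALM_fejer xsol.
have [l l0 lP] := omega_sqdist_coercive xs ws.
have [M0 M00 M0P] := pinfty_ex_gt0 abnd.
have sqle (V : normedModType R) (v vs : V) B : 0 <= B -> `|v - vs| ^+ 2 <= B ->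
    `|v| <= B + 1 + `|vs|.
  move=> B0 vB; rewrite -[v](subrK vs) (le_trans (ler_normD _ _))// lerD2r.
  by have := normr_ge0 (v - vs); nra.
exists (Num.max (M0 + 1 + `|xs|) (M0 / l + 1 + `|ws|)) => k.
have [h1 h2] := lP k.
have {}M0P : omega_sqdist xs ws k <= M0.
  by apply: le_trans (ler_norm _) _; exact: M0P.
rewrite !le_max; split; apply/orP; [left|right].
  by apply: sqle; [exact: ltW|exact: le_trans M0P].
apply: sqle; first by rewrite divr_ge0 ?ltW.
by rewrite ler_pdivlMr// mulrC; exact: le_trans M0P.
Qed.

(** Along a filter on which the iterates converge, the steps and residuals
    vanish; pass to the limit in [iPALM_subgradient] and in the constraint. *)
Lemma iPALM_cluster_KKT xa wa : (exists xs ws, KKT phi gradh A At c xs ws) ->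
  cluster ((fun k => (x k, w k)) @ \oo) (xa, wa) -> KKT phi gradh A At c xa wa.
Proof.
move=> [xs [ws xsol]] /cluster_refine[G [Gp Goo Gz]].
have [_ dx dw] := iPALM_fejer xsol.
have xG : x @ G --> xa.
  by apply: (cvg_comp (fun k => (x k, w k)) fst Gz); exact: cvg_fst.
have wG : w @ G --> wa.
  by apply: (cvg_comp (fun k => (x k, w k)) snd Gz); exact: cvg_snd.
have dxG : x k.+1 - x k @[k --> G] --> 0 by exact: cvg_trans (cvg_app _ Goo) dx.
have dwG : w k.+1 - w k @[k --> G] --> 0 by exact: cvg_trans (cvg_app _ Goo) dw.
have wSG : w k.+1 @[k --> G] --> wa.
  rewrite -[X in _ --> X]addr0.
  under eq_fun => k do rewrite -(subrKC (w k) (w k.+1)).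
  exact: cvgD.
have rG : At (w k.+1) - c @[k --> G] --> 0.
  have ts : tau * sigma != 0 by rewrite gt_eqF ?mulr_gt0.
  have -> : (fun k => At (w k.+1) - c)
      = (fun k => (tau * sigma)^-1 *: (x k.+1 - x k)).
    apply/funext => k; have [_ _ ->] := xw_iPALM k.
    by rewrite addrAC subrr add0r scalerA mulVf// scale1r.
  by rewrite -(scaler0 _ (tau * sigma)^-1); exact: cvgZl_tmp.
have dG : d @ G --> 0.
  apply: cvg_trans (cvg_app _ Goo) _; apply/norm_cvg0P.
  have e0 := cvg_series_cvg_0 eps_summable.
  apply: (@squeeze_cvgr _ _ _ _ (cst 0) _ _ _ _ _ e0); last exact: cvg_cst.
  by apply: nearW => k /=; rewrite normr_ge0; have [] := xw_iPALM k.
have hc (V1 V2 : finHilbertType R) (f : 'Hom(V1, V2)) (u : nat -> V1) a :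
    u @ G --> a -> f (u k) @[k --> G] --> f a.
  by move=> ua; apply: continuous_cvg => //; exact: hom_continuous.
split.
  exists (- gradh wa - A xa); last by rewrite addrAC subrK addNr.
  apply: (subdiff_closed phi_cpc wSG _ iPALM_subgradient).
  have -> : - gradh wa - A xa =
      0 - (Sigma 0 + Sop 0) - gradh wa - A (xa + sigma *: 0).
    by rewrite !linear0 !addr0 subr0 sub0r.
  apply: cvgB.
    apply: cvgB.
      by apply: cvgB; [exact: dG|apply: cvgD; exact: hc].
    by apply: continuous_cvg; [exact: gradh_cont|exact: wG].
  by apply: hc; apply: cvgD => //; exact: cvgZl_tmp.
have AtG : At (w k.+1) - c @[k --> G] --> At wa - c.
  by apply: cvgB; [exact: hc|exact: cvg_cst].
exact: cvg_unique AtG rG.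
Qed.

(** Opial's argument: the distance to a cluster point converges, since that
    point is a solution, and it tends to 0 along a finer filter; so it
    tends to 0. *)
Lemma iPALM_cvg : (exists xs ws, KKT phi gradh A At c xs ws) ->
  exists xl wl, KKT phi gradh A At c xl wl /\
    (fun k => (x k, w k)) @ \oo --> (xl, wl).
Proof.
move=> /[dup] KKTn0 [xs [ws xsol]].
have [M MP] := iPALM_bounded xsol.
have [[xl wl] [_ cl]] : ([set u : X | `|u| <= M] `*` [set v : W | `|v| <= M])
    `&` cluster ((fun k => (x k, w k)) @ \oo) !=set0.
  apply: (compact_setX (@ball_compact _ X M) (@ball_compact _ W M)).
  by exists 0%N => // k _; split; have [] := MP k.
have lsol := iPALM_cluster_KKT KKTn0 cl.
exists xl, wl; split=> //.
have [acvg _ _] := iPALM_fejer lsol.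
have a0 : omega_sqdist xl wl @ \oo --> 0.
  have [G [Gp Goo Gz]] := cluster_refine cl.
  have xG : x @ G --> xl.
    by apply: (cvg_comp (fun k => (x k, w k)) fst Gz); exact: cvg_fst.
  have wG : w @ G --> wl.
    by apply: (cvg_comp (fun k => (x k, w k)) snd Gz); exact: cvg_snd.
  suff aG : omega_sqdist xl wl @ G --> 0.
    have limG : omega_sqdist xl wl @ G --> limn (omega_sqdist xl wl).
      exact: cvg_trans (cvg_app _ Goo) acvg.
    by rewrite -(cvg_unique _ limG aG).
  rewrite (funext (omega_sqdistE xl wl)).
  have -> : 0 = `|xl - xl| ^+ 2
      + sqnorm (Theta A At Sigma sigma tau Sop) (wl - wl).
    by rewrite !subrr normr0 expr0n /sqnorm inner0l addr0.
  apply: cvgD.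
    rewrite -innerxx; under eq_fun do rewrite -innerxx.
    by apply: cvg_inner; apply: cvgB => //; exact: cvg_cst.
  have wlG : w k - wl @[k --> G] --> wl - wl.
    by apply: cvgB => //; exact: cvg_cst.
  exact: (cvg_comp _ _ wlG (@sqnorm_continuous _ _ _ (wl - wl))).
have [l l0 lP] := omega_sqdist_coercive xl wl.
apply: cvg_pair => /=; apply/subr_cvg0.
  apply: (cvg0_sqr_le (m := 1) ltr01 _ a0) => k.
  by rewrite mul1r; have [] := lP k.
by apply: (cvg0_sqr_le l0 _ a0) => k; have [] := lP k.
Qed.

End Algorithm.

Theorem theorem3p1 (R : realType) (X W : finHilbertType R)
    (phi : W -> \bar R) (h : W -> R) (gradh : W -> W)
    (A : 'Hom(X, W)) (At : 'Hom(W, X)) (c : X) (Sigma Sop : 'End(W))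
    (sigma tau : R) (eps : nat -> R)
    (x : nat -> X) (w d : nat -> W)
    (phi_cpc : closed_proper_convex phi)
    (h_convex : convex_function [set: W] h)
    (h_grad : is_gradient h gradh)
    (gradh_cont : continuous gradh)
    (gradh_lip : lipschitz gradh)
    (A_adj : is_adjoint A At)
    (Sigma_sa : self_adjoint Sigma) (Sigma_psd : psd Sigma)
    (h_major : forall u u', h u <= hhat h gradh Sigma u u')
    (sigma_gt0 : 0 < sigma) (tau_gt0 : 0 < tau) (tau_lt2 : tau < 2)
    (eps_ge0 : forall k, 0 <= eps k) (eps_summable : cvgn (series eps))
    (S_sa : self_adjoint Sop)
    (KKT_nonempty : exists (xs : X) (ws : W), KKT phi gradh A At c xs ws)
    (S_ge : loewner_ge Sop (- (2^-1 *: Sigma)))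
    (S_gt : loewner_gt (2^-1 *: Sigma + sigma *: (A \o At)%VF + Sop) 0)
    (xw_iPALM : iPALM phi h gradh At c Sigma sigma tau Sop eps x w d) :
  [/\ (forall (xs : X) (ws : W), KKT phi gradh A At c xs ws ->
        forall k : nat, (1 <= k)%N ->
        sqnorm_Omega A At Sigma sigma tau Sop (x k.+1 - xs, w k.+1 - ws)
          - sqnorm_Omega A At Sigma sigma tau Sop (x k - xs, w k - ws)
        <= - ((2 - tau) / (3 * tau) * `|x k.+1 - x k| ^+ 2
              + sqnorm (Xi A At Sigma sigma tau Sop) (w k.+1 - w k)
              - 2 * tau * sigma * inner (d k) (w k.+1 - ws))),
      bounded_fun (fun k => (x k, w k)),
      (forall (xa : X) (wa : W),
        cluster ((fun k => (x k, w k)) @ \oo) (xa, wa) ->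
        KKT phi gradh A At c xa wa)
    & exists (xl : X) (wl : W),
        KKT phi gradh A At c xl wl /\
        (fun k => (x k, w k)) @ \oo --> (xl, wl)].
Proof.
split.
- move=> xs ws xsol k _; exact: (iPALM_descent phi_cpc h_convex h_grad A_adj
    Sigma_sa h_major sigma_gt0 tau_gt0 tau_lt2 S_sa xw_iPALM).
- have [xs [ws xsol]] := KKT_nonempty.
  have [M MP] := iPALM_bounded phi_cpc h_convex h_grad A_adj Sigma_sa h_major
    Sigma_psd sigma_gt0 tau_gt0 tau_lt2 S_sa eps_ge0 eps_summable S_ge S_gt
    xw_iPALM xsol.
  exists M; split=> [|N MN k _ /=]; first exact: num_real.
  have [xM wM] := MP k.
  by rewrite prod_normE /= ge_max !(le_trans _ (ltW MN)).
- move=> xa wa; exact: (iPALM_cluster_KKT phi_cpc h_convex h_grad A_adj Sigma_sa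
    h_major gradh_cont Sigma_psd sigma_gt0 tau_gt0 tau_lt2 S_sa eps_ge0
    eps_summable S_ge S_gt xw_iPALM KKT_nonempty).
- exact: (iPALM_cvg phi_cpc h_convex h_grad A_adj Sigma_sa
    h_major gradh_cont Sigma_psd sigma_gt0 tau_gt0 tau_lt2 S_sa eps_ge0
    eps_summable S_ge S_gt xw_iPALM KKT_nonempty).
Qed.
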